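(* Let $k$ be a field and let $\mathcal A$ be a finite set of hyperplanes through the origin in $\mathbb R^d$, with face semigroup $\mathcal F$, intersection lattice $\mathcal L$ and face semigroup algebra $k\mathcal F$. The quiver $\mathcal Q$ of $k\mathcal F$ is given by the Hasse diagram of the intersection lattice $\mathcal L$, with the cover relations oriented by $X\to Y$ iff $X\gtrdot Y$. That is, the vertices of $\mathcal Q$ are the elements of $\mathcal L$ (with $X\in\mathcal L$ corresponding to the simple module $k_X$), and there is exactly one arrow $X\to Y$ if $X$ covers $Y$ in $\mathcal L$ and no arrow $X\to Y$ otherwise.
   Context: For each $H\in\mathcal A$ fix a labelling $H^+,H^-$ of the two open half-spaces determined by $H$, and put $H^0=H$. A face of $\mathcal A$ is a nonempty set of the form $x=\bigcap_{H\in\mathcal A}H^{\sigma_H}$ with $\sigma_H\in\{+,-,0\}$; write $\sigma_H(x)=\sigma_H$. $\mathcal F$ is the set of faces. The support of a face is $\operatorname{supp}(x)=\bigcap_{H:\sigma_H(x)=0}H$ (equal to $\mathbb R^d$ if no $\sigma_H(x)$ is $0$). The intersection lattice $\mathcal L=\operatorname{supp}(\mathcal F)$ is ordered by inclusion; $X\gtrdot Y$ means $X$ covers $Y$, i.e. $Y<X$ with nothing strictly between. The product $xy$ of faces is the face with $\sigma_H(xy)=\sigma_H(x)$ if $\sigma_H(x)\ne0$ and $\sigma_H(xy)=\sigma_H(y)$ if $\sigma_H(x)=0$. This makes $\mathcal F$ a semigroup with identity $1=\bigcap_{H\in\mathcal A}H$, and $k\mathcal F$ is its semigroup algebra over $k$.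 Modules are left modules. For $X\in\mathcal L$, $k_X$ is the one-dimensional $k\mathcal F$-module on which a face $y$ acts as $1$ if $\operatorname{supp}(y)\le X$ and as $0$ otherwise; the $k_X$ are the simple $k\mathcal F$-modules. The (Ext-)quiver of a finite dimensional $k$-algebra $A$ all of whose simple modules are one-dimensional is the directed graph with one vertex for each isomorphism class of simple $A$-modules and with $\dim_k\operatorname{Ext}^1_A(S_x,S_y)$ arrows $x\to y$, where $S_x,S_y$ are the simple modules corresponding to $x,y$. *)

(* Defs.v *)
From HB Require Import structures.
From mathcomp Require Import all_boot all_order all_algebra.
From mathcomp Require Import finmap.
From mathcomp Require Import boolp classical_sets reals.
From mathcomp Require Import monalg.

Set Implicit Arguments.
Unset Strict Implicit.
Unset Printing Implicit Defensive.

Import Order.TTheory GRing.Theory Num.Theory.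
Local Open Scope classical_set_scope.
Local Open Scope ring_scope.

(** * The Ext-quiver of an algebra *)

Section Modules.
Variables (k : fieldType) (A : algType k).

Definition simple_module (M : lmodType A) : Prop :=
  (exists x : M, x != 0) /\
  forall S : {pred M}, submod_closed S -> S =i pred1 0 \/ S =i predT.

Definition isomorphic (M N : lmodType A) : Prop :=
  exists f : {linear M -> N}, bijective f.

(* The k-structure of an A-module is c, m |-> c%:A *: m. *)
Definition kdim (M : lmodType A) (n : nat) : Prop :=
  exists b : 'I_n -> M, forall x : M,
    exists! c : {ffun 'I_n -> k}, x = \sum_i (c i)%:A *: b i.

Definition surjective (M N : Type) (f : M -> N) : Prop :=
  forall y, exists x, f x = y.

Definition exact_at (M N P : lmodType A)
    (f : {linear M -> N}) (g : {linear N -> P}) : Prop :=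
  forall y, g y = 0 <-> exists x, f x = y.

Definition projective (P : lmodType A) : Prop :=
  forall (M N : lmodType A) (g : {linear M -> N}) (f : {linear P -> N}),
    surjective g -> exists h : {linear P -> M}, forall p, g (h p) = f p.

Record proj_resolution (M : lmodType A) := ProjResolution {
  res :> nat -> lmodType A;
  bdry : forall n, {linear res n.+1 -> res n};
  augm : {linear res 0 -> M};
  res_projective : forall n, projective (res n);
  augm_surj : surjective augm;
  augm_exact : exact_at (bdry 0) augm;
  bdry_exact : forall n, exact_at (bdry n.+1) (bdry n)
}.

Section Ext1.
Variables (M N : lmodType A) (P : proj_resolution M).

Definition cocycle1 (f : {linear P 1 -> N}) : Prop :=
  forall x, f (bdry P 1 x) = 0.

Definition coboundary1 (f : P 1 -> N) : Prop :=
  exists g : {linear P 0 -> N}, forall x, f x = g (bdry P 0 x).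

(* dim_k H^1(Hom_A(P, N)) = n: the classes of some cocycles b_0, ..., b_(n-1)
   form a k-basis of cocycles modulo coboundaries. *)
Definition H1dim (n : nat) : Prop :=
  exists2 b : 'I_n -> {linear P 1 -> N}, (forall i, cocycle1 (b i)) &
    forall f : {linear P 1 -> N}, cocycle1 f ->
      exists! c : {ffun 'I_n -> k},
        coboundary1 (fun x => f x - \sum_i (c i)%:A *: b i x).
End Ext1.

(* dim_k Ext^1_A(M, N) = n.  Ext^1 does not depend on the resolution, and
   resolutions exist (proj_resolution_exists below), so that this is not
   vacuous. *)
Definition ext1_dim (M N : lmodType A) (n : nat) : Prop :=
  forall P : proj_resolution M, H1dim N P n.

End Modules.

Arguments kdim {k A} M n.

(* A directed multigraph with finitely many arrows x -> y for all x, y. *)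
Record quiver := Quiver {
  vertex :> Type;
  arrows : vertex -> vertex -> nat
}.

(* Q is the Ext-quiver of A, the vertex x standing for the isomorphism class
   of the simple module S x. The first two clauses are the conditions under
   which the quiver is defined. *)
Definition is_ext_quiver (k : fieldType) (A : algType k)
    (Q : quiver) (S : Q -> lmodType A) : Prop :=
  [/\ exists n, kdim (A^o : lmodType A) n,
      forall M : lmodType A, simple_module M -> kdim M 1,
      [/\ forall x, simple_module (S x),
          forall x y, isomorphic (S x) (S y) -> x = y
        & forall M : lmodType A, simple_module M ->
            exists x, isomorphic M (S x)]
    & forall x y, ext1_dim (S x) (S y) (arrows x y)].

(** * Existence of projective resolutions *)

Section FreeModule.
Variables (k : fieldType) (A : algType k) (T : choiceType) (M : lmodType A).
Variable phi : T -> M.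

Definition free_lift (g : {malg A[T]}) : M :=
  \sum_(x <- msupp g) g@_x *: phi x.

Lemma free_liftEw (d : {fset T}) (g : {malg A[T]}) :
  (msupp g `<=` d)%fset -> free_lift g = \sum_(x <- d) g@_x *: phi x.
Proof.
move=> le; rewrite /free_lift (big_fset_incl _ le) // => x _ xg.
by rewrite mcoeff_outdom // scale0r.
Qed.

Lemma free_lift_is_linear : linear free_lift.
Proof.
move=> a g h; pose d := (msupp g `|` msupp h `|` msupp (a *: g + h))%fset.
have dg : (msupp g `<=` d)%fset by rewrite /d -fsetUA fsubsetUl.
have dh : (msupp h `<=` d)%fset
  by rewrite /d (fsetUC (msupp g)) -fsetUA fsubsetUl.
have dgh : (msupp (a *: g + h) `<=` d)%fset by rewrite /d fsubsetUr.
rewrite (free_liftEw dg) (free_liftEw dh) (free_liftEw dgh).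
rewrite scaler_sumr -big_split /=; apply: eq_bigr => x _.
by rewrite mcoeffD mcoeffZ scalerDl scalerA.
Qed.

HB.instance Definition _ :=
  GRing.isLinear.Build A {malg A[T]} M *:%R free_lift free_lift_is_linear.

Lemma free_liftU x : free_lift << x >> = phi x.
Proof.
rewrite (free_liftEw (d := [fset x]%fset)) ?msuppU_le // big_seq_fset1.
by rewrite mcoeffUU scale1r.
Qed.

Lemma free_lift_unique (f : {linear {malg A[T]} -> M}) :
  (forall x, f << x >> = phi x) -> f =1 free_lift.
Proof.
move=> fphi g; rewrite [in LHS](monalgE g) linear_sum; apply: eq_bigr => x _.
rewrite -fphi -linearZ; congr (f _); apply/malgP => y.
by rewrite mcoeffZ !mcoeffU; case: (x == y); rewrite ?mulr1 ?mulr0.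
Qed.
End FreeModule.

Section Resolutions.
Variables (k : fieldType) (A : algType k).

Lemma free_projective (T : choiceType) : projective ({malg A[T]} : lmodType A).
Proof.
move=> M N g f gsurj.
have /choice [phi phiP] : forall x : T, exists m, g m = f << x >>.
  by move=> x; apply: gsurj.
exists (free_lift phi) => p.
pose h : {linear {malg A[T]} -> N} := g \o free_lift phi.
have -> : f p = free_lift (fun x => f << x >>) p by apply: free_lift_unique.
have := @free_lift_unique _ _ _ _ (fun x => f << x >>) h; apply => x.
by rewrite /= free_liftU phiP.
Qed.

Section Cover.
Variables (P Q : lmodType A) (f : {linear P -> Q}).
Let K : choiceType := {x : P | f x == 0}.
Definition ker_cover : lmodType A := {malg A[K]}.
Definition ker_cover_map : {linear ker_cover -> P} :=
  free_lift (val : K -> P).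

Lemma ker_cover_exact : exact_at ker_cover_map f.
Proof.
move=> y; split=> [fy0 | [x <-]].
  have fy : f y == 0 by apply/eqP.
  by exists << (exist _ y fy : K) >>; rewrite /= free_liftU.
rewrite /ker_cover_map /= /free_lift linear_sum big1 // => z _.
by rewrite linearZ /= (eqP (valP z)) scaler0.
Qed.
End Cover.

Record stage := Stage {
  st_src : lmodType A; st_tgt : lmodType A; st_map : {linear st_src -> st_tgt} }.

Definition next_stage (s : stage) : stage := Stage (ker_cover_map (st_map s)).

Lemma proj_resolution_exists (M : lmodType A) : inhabited (proj_resolution M).
Proof.
pose s0 : stage := Stage (free_lift (id : M -> M)).
pose s n := iter n next_stage s0.
have proj n : projective (st_src (s n)).
  by case: n => [|n]; exact: free_projective.
split; apply: (@ProjResolution k A M (fun n => st_src (s n))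
  (fun n => st_map (s n.+1)) (st_map (s 0)) proj).
- by move=> y; exists << y >>; rewrite /= free_liftU.
- exact: ker_cover_exact.
- by move=> n; apply: ker_cover_exact.
Qed.
End Resolutions.

(** * Central hyperplane arrangements in R^d *)

(* form H carries the labelling of the two open half-spaces determined by H:
   H^+ is where it is positive, H^- where it is negative. *)
Record arrangement (R : realType) (d : nat) := Arrangement {
  planes : {fset {vspace 'rV[R]_d}};
  form : planes -> {linear 'rV[R]_d -> R^o};
  planes_dim : forall H : planes, (\dim (val H)).+1 = d;
  formP : forall (H : planes) v, (v \in val H) = (form H v == 0)
}.

Variant sign := Pos | Neg | Zero.

Definition sign_to_ord (s : sign) : 'I_3 :=
  match s with
  | Pos => @Ordinal 3 0 isT
  | Neg => @Ordinal 3 1 isT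
  | Zero => @Ordinal 3 2 isT
  end.
Definition ord_to_sign (i : 'I_3) : sign :=
  match val i with 0%N => Pos | 1%N => Neg | _ => Zero end.
Lemma sign_to_ordK : cancel sign_to_ord ord_to_sign.
Proof. by case. Qed.
HB.instance Definition _ := Finite.copy sign (can_type sign_to_ordK).

Section Arrangement.
Variables (R : realType) (d : nat) (A : arrangement R d).
Local Notation V := 'rV[R]_d.
Local Notation signs := {ffun planes A -> sign}.

Definition half_space (H : planes A) (s : sign) : set V :=
  match s with
  | Pos => [set v | 0 < form H v]
  | Neg => [set v | form H v < 0]
  | Zero => [set v | v \in val H]
  end.

Definition cell (s : signs) : set V :=
  \bigcap_(H in [set: planes A]) half_space H (s H).

(* A face is encoded by its sign vector, of which it is the (nonempty) cell;
   the encoding is faithful by face_cell_inj. *)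
Record face := Face { fsign :> signs; _ : `[< cell fsign !=set0 >] }.

HB.instance Definition _ := [isSub for fsign].
HB.instance Definition _ := [Finite of face by <:].

Lemma face_cellP (x : face) : cell x !=set0.
Proof. by apply/asboolP; case: x. Qed.

Lemma half_space_inj H s t v : half_space H s v -> half_space H t v -> s = t.
Proof.
case: s; case: t => //=; rewrite ?formP.
- by move=> /lt_trans h /h; rewrite ltxx.
- by move=> /[swap] /eqP ->; rewrite ltxx.
- by move=> /[swap] /lt_trans h /h; rewrite ltxx.
- by move=> /[swap] /eqP ->; rewrite ltxx.
- by move=> /eqP ->; rewrite ltxx.
- by move=> /eqP ->; rewrite ltxx.
Qed.

Lemma face_cell_inj (x y : face) : cell x = cell y -> x = y.
Proof.
move=> exy; apply/val_inj/ffunP => H /=.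
have [v xv] := face_cellP x; have yv := xv; rewrite exy in yv.
exact: half_space_inj (xv H I) (yv H I).
Qed.

Definition sign_mul (s t : sign) : sign := if s is Zero then t else s.
Definition signs_mul (x y : signs) : signs := [ffun H => sign_mul (x H) (y H)].

Lemma signs_mul_subproof (x y : face) : `[< cell (signs_mul x y) !=set0 >].
Proof.
apply/asboolP; have [p xp] := face_cellP x; have [q yq] := face_cellP y.
have [e e0 eP] : exists2 e : R, 0 < e & forall H : planes A,
    form H p != 0 -> e * `|form H q : R| < `|form H p : R|.
  suff [e e0 eP] : exists2 e : R, 0 < e & forall H, H \in enum {: planes A} ->
      form H p != 0 -> e * `|form H q : R| < `|form H p : R|.
    by exists e => // H; apply: eP; rewrite mem_enum.
  elim: (enum _) => [|H s [e e0 eP]]; first by exists 1.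
  have [fp0|fp0] := eqVneq (form H p) 0.
    exists e => // H'; rewrite inE => /orP[/eqP ->|]; last exact: eP.
    by rewrite fp0 eqxx.
  pose c : R := `|form H p : R| / (1 + `|form H q : R|).
  have q1 : 0 < 1 + `|form H q : R| by rewrite ltr_pwDl ?ltr01.
  have c0 : 0 < c by rewrite divr_gt0 // normr_gt0.
  exists (Num.min e c); first by rewrite lt_min e0 c0.
  move=> H'; rewrite inE => /orP[/eqP -> _|H's fp].
    apply: (@le_lt_trans _ _ (c * `|form H q : R|)).
      by rewrite ler_wpM2r // ge_min lexx orbT.
    rewrite /c mulrAC ltr_pdivrMr // ltr_pM2l ?normr_gt0 //.
    by rewrite ltrDr ltr01.
  by apply: (le_lt_trans _ (eP _ H's fp)); rewrite ler_wpM2r // ge_min lexx.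
exists (p + e *: q) => H _.
rewrite /half_space ffunE; have := xp H I; have := yq H I; have := eP H.
have lin : form H (p + e *: q) = form H p + e * form H q :> R.
  by rewrite linearD linearZ.
case: (x H) => /=; rewrite ?formP.
- move=> h _ fp; rewrite lin.
  have := h (lt0r_neq0 fp); rewrite (gtr0_norm fp) => {}h.
  rewrite -ltrBlDr sub0r; apply: (le_lt_trans _ h).
  by rewrite -mulrN ler_pM2l // -normrN ler_norm.
- move=> h _ fp; rewrite lin.
  have := h (ltr0_neq0 fp); rewrite (ltr0_norm fp) ltrNr => {}h.
  rewrite -ltrBrDr sub0r; apply: (lt_le_trans h).
  by rewrite lerN2 ler_pM2l // ler_norm.
- move=> _ yH /eqP fp0; move: yH; rewrite /sign_mul.
  by case: (y H) => /=; rewrite ?formP lin fp0 add0r;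
    rewrite ?pmulr_rgt0 ?pmulr_rlt0 // => /eqP ->; rewrite mulr0.
Qed.

Lemma signs_one_subproof : `[< cell [ffun=> Zero] !=set0 >].
Proof. by apply/asboolP; exists 0 => H _; rewrite /half_space ffunE /= mem0v. Qed.

Definition face_mul (x y : face) : face := Face (signs_mul_subproof x y).
Definition face_one : face := Face signs_one_subproof.

Lemma face_mulA : associative face_mul.
Proof.
by move=> x y z; apply/val_inj/ffunP => H; rewrite !ffunE; case: (x H).
Qed.
Lemma face_mul1r : left_id face_one face_mul.
Proof. by move=> x; apply/val_inj/ffunP => H; rewrite !ffunE. Qed.
Lemma face_mulr1 : right_id face_one face_mul.
Proof.
by move=> x; apply/val_inj/ffunP => H; rewrite !ffunE; case: (x H).
Qed.
Lemma face_unit x y : face_mul x y = face_one -> x = face_one /\ y = face_one.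
Proof.
move=> /(congr1 val)/ffunP e.
by split; apply/val_inj/ffunP => H; have := e H; rewrite !ffunE; case: (x H).
Qed.

HB.instance Definition _ := Choice_isMonomialDef.Build face
  face_mulA face_mul1r face_mulr1 face_unit.

Definition supp (x : face) : {vspace V} :=
  (\bigcap_(H : planes A | x H == Zero) val H)%VS.

Lemma supp_sub_plane (x : face) (H : planes A) :
  (supp x <= val H)%VS = (x H == Zero).
Proof.
apply/idP/idP => [/subvP le|xH]; last by rewrite /supp (bigcapv_inf H).
have [p xp] := face_cellP x; apply/eqP; apply: half_space_inj (xp H I) _ => /=.
apply: le; rewrite memvE; apply/subv_bigcapP => K /eqP xK.
by rewrite -memvE; have := xp K I; rewrite /half_space xK.
Qed.

Record lattice := Flat {
  flat :> {vspace V};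
  _ : `[< exists x : face, supp x = flat >]
}.

HB.instance Definition _ := [isSub for flat].
HB.instance Definition _ := [Choice of lattice by <:].

Definition flat_le (X Y : lattice) : bool := (flat X <= flat Y)%VS.

Lemma flat_le_refl : reflexive flat_le. Proof. by move=> X; exact: subvv. Qed.
Lemma flat_le_anti : antisymmetric flat_le.
Proof. by move=> X Y h; apply/val_inj/eqP; rewrite eqEsubv. Qed.
Lemma flat_le_trans : transitive flat_le.
Proof. by move=> Y X Z; exact: subv_trans. Qed.

HB.instance Definition _ := Order.Le_isPOrder.Build (Order.Disp tt tt) lattice
  flat_le_refl flat_le_anti flat_le_trans.

End Arrangement.

Definition covers (disp : Order.disp_t) (T : porderType disp) (x y : T) : Prop :=
  (y < x)%O /\ ~ exists z : T, (y < z)%O /\ (z < x)%O.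

Definition hasse_quiver (disp : Order.disp_t) (T : porderType disp) : quiver :=
  {| vertex := T;
     arrows := fun x y => if `[< covers x y >] then 1%N else 0%N |}.

(** * The face semigroup algebra and its simple modules *)

Lemma malg_scaleAr (K : monomType) (k : comNzRingType) (c : k)
    (g h : {malg k[K]}) : c *: (g * h) = g * (c *: h).
Proof.
rewrite (malgMEw (fsubset_refl (msupp g)) (msuppZ_le c h)) malgME scaler_sumr.
apply: eq_bigr => y _; rewrite scaler_sumr; apply: eq_bigr => z _.
by apply/malgP => w; rewrite !mcoeffsE mulrnAr mulrCA.
Qed.

(* An alias, because the library declares {malg k[K]} to be an algebra, and not
   merely a left algebra, only for a commutative monoid K. *)
Definition face_algebra (k : fieldType) (R : realType) (d : nat)
  (A : arrangement R d) : Type := {malg k[face A]}.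

(* The module k_X.  A face y acts on it as 1 if supp y <= X and as 0 otherwise,
   see simple_at_face. *)
Definition simple_at (k : fieldType) (R : realType) (d : nat)
  (A : arrangement R d) (X : lattice A) : Type := k.

Section FaceAlgebra.
Variables (k : fieldType) (R : realType) (d : nat) (A : arrangement R d).

HB.instance Definition _ :=
  GRing.Lalgebra.copy (face_algebra k A) {malg k[face A]}.
HB.instance Definition _ :=
  GRing.Lalgebra_isAlgebra.Build k (face_algebra k A)
    (@malg_scaleAr (face A) k).

Section SimpleAt.
Variable X : lattice A.

Lemma supp_mul (x y : face A) :
  (supp (mmul x y) <= X)%VS = (supp x <= X)%VS && (supp y <= X)%VS.
Proof.
have [z Xz] : exists z : face A, supp z = X by apply/asboolP; case: X.
apply/idP/andP => [le|[xX yX]].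
  by split; apply: subv_trans le; apply/subv_bigcapP => H;
    rewrite supp_sub_plane ffunE => /eqP; case: (x H) => //= ->.
rewrite -Xz; apply/subv_bigcapP => H zH; rewrite supp_sub_plane ffunE.
have XH : (X <= val H)%VS by rewrite -Xz supp_sub_plane.
have := subv_trans xX XH; have := subv_trans yX XH.
by rewrite !supp_sub_plane => /eqP -> /eqP ->.
Qed.

Definition supp_le (y : face A) : k := (supp y <= X)%VS%:R.

Lemma supp_le_mmorphism : mmorphism supp_le.
Proof.
split=> [x y|]; first by rewrite /supp_le supp_mul -natrM mulnb.
have [z Xz] : exists z : face A, supp z = X by apply/asboolP; case: X.
rewrite /supp_le -Xz; have -> // : (supp (@mone (face A)) <= supp z)%VS.
by apply/subv_bigcapP => H _; rewrite supp_sub_plane ffunE.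
Qed.
HB.instance Definition _ :=
  isMultiplicative.Build (face A) k supp_le supp_le_mmorphism.

Definition act (a : face_algebra k A) : k := mmap idfun supp_le a.

HB.instance Definition _ := GRing.Zmodule.copy (simple_at k X) k.

Definition simple_scale (a : face_algebra k A) (v : simple_at k X)
    : simple_at k X :=
  act a * v.

Lemma simple_scaleA a b v :
  simple_scale a (simple_scale b v) = simple_scale (a * b) v.
Proof. by rewrite /simple_scale /act mulrA rmorphM. Qed.
Lemma simple_scale1 : left_id 1 simple_scale.
Proof. by move=> v; rewrite /simple_scale /act rmorph1 mul1r. Qed.
Lemma simple_scaleDr : right_distributive simple_scale +%R.
Proof. by move=> a u v; rewrite /simple_scale mulrDr. Qed.
Lemma simple_scaleDl v : {morph simple_scale^~ v : a b / a + b}.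
Proof. by move=> a b; rewrite /simple_scale /act raddfD mulrDl. Qed.

HB.instance Definition _ :=
  GRing.Zmodule_isLmodule.Build (face_algebra k A) (simple_at k X)
    simple_scaleA simple_scale1 simple_scaleDr simple_scaleDl.

Lemma simple_at_face (y : face A) (v : k) :
  (<< y >> : face_algebra k A) *: (v : simple_at k X) =
  if (supp y <= X)%VS then v else 0.
Proof.
rewrite /GRing.scale /= /simple_scale /act mmapU mul1r /supp_le.
by case: ifP; rewrite ?mul1r ?mul0r.
Qed.

End SimpleAt.
End FaceAlgebra.

(* Main.v *)
Require Import Defs.
From HB Require Import structures.
From mathcomp Require Import all_boot all_order all_algebra.
From mathcomp Require Import reals.
From mathcomp Require Import finmap boolp monalg.
From mathcomp Require Import ring lra.

Set Implicit Arguments.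
Unset Strict Implicit.
Unset Printing Implicit Defensive.

Import Order.TTheory GRing.Theory Num.Theory.
Local Open Scope ring_scope.

(** Write B for the face algebra, and chi_X for the character by which it acts
    on k_X.

    Simple modules.  Let M be simple and let x be a face that does not kill M,
    of largest possible support.  If supp y <= supp x, then xy = x; otherwise
    xy has a larger support than x, hence kills M.  Therefore the kernel of x
    on M is a submodule, so it is zero, and x may be cancelled from both sides:
    y acts as 1 in the first case and as 0 in the second
    (simple_module_act).  As B acts by the scalars chi_X, every line of M is a
    submodule, and M is k_X.

    Extensions.  For a one-dimensional module k_chi and any module N,
    Ext^1(k_chi, N) is the space of derivations D : B -> N, that is, of linear
    maps with D(ab) = a D(b) + chi(b) D(a), modulo the inner ones
    a |-> an - chi(a)n (ext1_dim_derivation).  For k_X and N = k_Y, such a D is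
    given by its values on faces, a function delta with
      delta(xy) = chi_Y(x) delta(y) + chi_X(y) delta(x).
    If Y is not contained in X, comparing delta on yxy = yx for a face y of
    support Y shows that delta is inner.  The same holds for X = Y, where
    x = xx gives delta = 0.

    So let Y < X.  Then delta vanishes outside the faces x that lie in X but
    not in Y, and delta(xy) = delta(x) for all such x and all y in X.  On the
    faces met by a segment of X that avoids Y, delta is constant: where the
    segment crosses a hyperplane, the face of the crossing point x and the
    adjacent faces y satisfy xy = y (constant_on_segment).  If X does not cover
    Y, the codimension of Y in X is at least 2, and any two points of X outside
    Y are joined by at most two such segments; so delta is a multiple of
    chi_Y - chi_X, which is inner.  If X covers Y, then Y is the intersection
    of X with one hyperplane H of the arrangement, and delta is given by its
    two values on the two sides of H.  These derivations form a plane, in which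
    the inner ones form a line. *)

(** * Ext^1 out of a one-dimensional module *)

Section Derivations.
Variables (k : fieldType) (A : algType k).

(** The k-structure of an A-module M is only available as the action of the
    central elements c%:A; the next three lemmas are the normalization rules
    for it. *)
Lemma scalar_act_comm (M : lmodType A) (c : k) (a : A) (m : M) :
  c%:A *: (a *: m) = a *: (c%:A *: m).
Proof. by rewrite !scalerA mulr_algl mulr_algr. Qed.

Lemma algZ_act (M : lmodType A) (c : k) (a : A) (m : M) :
  (c *: a) *: m = c%:A *: (a *: m).
Proof. by rewrite scalerA mulr_algl. Qed.

Lemma algA_act (M : lmodType A) (c c' : k) (m : M) :
  c%:A *: (c'%:A *: m) = (c * c')%:A *: m.
Proof. by rewrite scalerA mulr_algl scalerA. Qed.

Lemma algA_act_inj (M : lmodType A) (m : M) (c c' : k) : m != 0 ->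
  c%:A *: m = c'%:A *: m -> c = c'.
Proof.
move=> m0 e; apply/eqP; rewrite -subr_eq0; apply: contraNT m0 => nz.
have {}e : (c - c')%:A *: m = 0 by rewrite scalerBl scalerBl e subrr.
by rewrite -[m]scale1r -(scale1r 1) -(mulVf nz) -algA_act e scaler0.
Qed.

Lemma linear_packed (U V : lmodType A) (f : U -> V) :
  linear f -> exists g : {linear U -> V}, g =1 f.
Proof.
move=> lin_f; pose L := GRing.isLinear.Build A U V *:%R f lin_f.
by pose g : {linear U -> V} := HB.pack f L; exists g.
Qed.

Variable chi : A -> k.

(** These are the Hochschild derivations with values in Hom_k(k_chi, N), A
    acting on the left through N and on the right through chi.  Linearity over
    k has to be required: a derivation of k itself would otherwise count. *)
Definition derivation (N : lmodType A) (D : A -> N) : Prop :=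
  [/\ forall a b, D (a + b) = D a + D b,
      forall (c : k) a, D (c *: a) = c%:A *: D a
    & forall a b, D (a * b) = a *: D b + (chi b)%:A *: D a].

Lemma derivation_sub_scale (N : lmodType A) (D D' : A -> N) (c : k) :
  derivation D -> derivation D' -> derivation (fun a => D a - c%:A *: D' a).
Proof.
move=> [DD DZ DM] [DD' DZ' DM']; split=> [a b|e a|a b].
- by rewrite DD DD' scalerDr opprD addrACA.
- by rewrite DZ DZ' scalerBr scalar_act_comm.
rewrite DM DM' !scalerBr !scalerDr opprD addrACA scalar_act_comm.
by rewrite [c%:A *: ((chi b)%:A *: _)]scalar_act_comm.
Qed.

Definition inner (N : lmodType A) (D : A -> N) : Prop :=
  exists n : N, forall a, D a = a *: n - (chi a)%:A *: n.

Definition derivation_dim (N : lmodType A) (n : nat) : Prop :=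
  exists2 b : 'I_n -> A -> N, (forall i, derivation (b i)) &
    forall D : A -> N, derivation D ->
      exists! c : {ffun 'I_n -> k},
        inner (fun a => D a - \sum_i (c i)%:A *: b i a).

End Derivations.

Section Extension.
Variables (k : fieldType) (A : algType k) (chi : A -> k) (N : lmodType A).
Hypotheses (chiD : forall a b, chi (a + b) = chi a + chi b)
  (chi1 : chi 1 = 1) (chiM : forall a b, chi (a * b) = chi a * chi b).
Variables (D : A -> N) (derD : derivation chi D).

(** The action on the extension of k_chi by N with cocycle D, in matrix form
    [[a, D a], [0, chi a]]; the derivation rule is its associativity. *)
Definition extension_scale (a : A) (v : N * k) : N * k :=
  (a *: v.1 + v.2%:A *: D a, chi a * v.2).

Lemma extension_scaleA a b v :
  extension_scale a (extension_scale b v) = extension_scale (a * b) v.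
Proof.
case: derD => _ _ DM; rewrite /extension_scale /= chiM mulrA.
congr (_, _); rewrite DM !scalerDr -(scalerA a b) -addrA; congr (_ + _).
by rewrite scalar_act_comm algA_act [v.2 * _]mulrC.
Qed.

Lemma extension_scale1 : left_id 1 extension_scale.
Proof.
case: derD => _ _ DM; have := DM 1 1.
rewrite mulr1 chi1 !scale1r => D1; have {}D1 : D 1 = 0.
  by apply: (addrI (D 1)); rewrite addr0 -D1.
by case=> n c; rewrite /extension_scale /= chi1 scale1r D1 scaler0 addr0 mul1r.
Qed.

Lemma extension_scaleDr : right_distributive extension_scale +%R.
Proof.
move=> a u v; congr (_, _); rewrite /= ?mulrDr //.
by rewrite !scalerDr !scalerDl addrACA.
Qed.

Lemma extension_scaleDl v : {morph extension_scale^~ v : a b / a + b}.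
Proof.
case: derD => DD _ _ a b; congr (_, _); rewrite /= ?chiD ?mulrDl //.
by rewrite scalerDl DD scalerDr addrACA.
Qed.

End Extension.

(** The hypotheses on chi and D are parameters, so that the module
    structure can be attached to the type. *)
Definition extension (k : fieldType) (A : algType k) (chi : A -> k)
    (N : lmodType A) (chiD : forall a b, chi (a + b) = chi a + chi b)
    (chi1 : chi 1 = 1) (chiM : forall a b, chi (a * b) = chi a * chi b)
    (D : A -> N) (derD : derivation chi D) : Type := (N * k)%type.

Section ExtensionModule.
Variables (k : fieldType) (A : algType k) (chi : A -> k) (N : lmodType A).
Hypotheses (chiD : forall a b, chi (a + b) = chi a + chi b)
  (chi1 : chi 1 = 1) (chiM : forall a b, chi (a * b) = chi a * chi b).
Variables (D : A -> N) (derD : derivation chi D).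
Local Notation E := (extension chiD chi1 chiM derD).

HB.instance Definition _ := GRing.Zmodule.copy E (N * k)%type.
HB.instance Definition _ :=
  GRing.Zmodule_isLmodule.Build A E
    (extension_scaleA chiM derD) (extension_scale1 chi1 derD)
    (@extension_scaleDr k A chi N D) (extension_scaleDl chiD derD).

End ExtensionModule.

Section Ext1.
Variables (k : fieldType) (A : algType k) (chi : A -> k) (M N : lmodType A).
Variable u : M.
Hypotheses (u_neq0 : u != 0) (u_gen : forall m : M, exists c : k, m = c%:A *: u)
  (u_act : forall a : A, a *: u = (chi a)%:A *: u).

Let coord_inj (c c' : k) : c%:A *: u = c'%:A *: u -> c = c'.
Proof. exact: algA_act_inj. Qed.

Let chiD a b : chi (a + b) = chi a + chi b.
Proof. by apply: coord_inj; rewrite -u_act !scalerDl -!u_act. Qed.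
Let chiZ (c : k) a : chi (c *: a) = c * chi a.
Proof.
by apply: coord_inj; rewrite -u_act algZ_act u_act algA_act.
Qed.
Let chi1 : chi 1 = 1.
Proof. by apply: coord_inj; rewrite -u_act !scale1r. Qed.
Let chiM a b : chi (a * b) = chi a * chi b.
Proof.
apply: coord_inj; rewrite -u_act -scalerA u_act -scalar_act_comm u_act algA_act.
by rewrite mulrC.
Qed.

Section Resolution.
Variable P : proj_resolution M.
Local Notation d0 := (bdry P 0).
Local Notation eps := (augm P).
Variables (p : P 0) (eps_p : eps p = u).

(** A cocycle f on P_1 is the same as a linear map fbar on ker(eps), the image
    of d0.  The line kp is a complement of ker(eps) in P_0, and
    ap - chi(a)p measures how far p is from spanning a submodule; the
    derivation attached to f is a |-> fbar(ap - chi(a)p). *)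
Definition induces (f : P 1 -> N) (D : A -> N) : Prop :=
  forall a w, d0 w = a *: p - (chi a)%:A *: p -> f w = D a.

Let eps_exact q : eps q = 0 <-> exists x, d0 x = q.
Proof. exact: (@augm_exact _ _ _ P q). Qed.
Let d0_exact q : d0 q = 0 <-> exists x, bdry P 1 x = q.
Proof. exact: (@bdry_exact _ _ _ P 0 q). Qed.

Let defect_bdry a : exists w, d0 w = a *: p - (chi a)%:A *: p.
Proof.
by apply/eps_exact; rewrite linearB !(linearZZ eps) eps_p u_act subrr.
Qed.

(** Exactness at P_1: what f kills contains the kernel of d0. *)
Lemma cocycle_factor (f : P 1 -> N) : linear f -> (forall x, f (bdry P 1 x) = 0) ->
  forall v w, d0 v = d0 w -> f v = f w.
Proof.
move=> /linear_packed[g gf] f0 v w e; apply/eqP; rewrite -!gf -subr_eq0 -linearB.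
have /d0_exact [x <-] : d0 (v - w) = 0 by rewrite linearB e subrr.
by rewrite gf f0.
Qed.

(** The derivation rule comes from
    abp - chi(ab)p = a(bp - chi(b)p) + chi(b)(ap - chi(a)p). *)
Lemma induced_derivation (f : P 1 -> N) : linear f ->
  (forall x, f (bdry P 1 x) = 0) -> exists2 D, derivation chi D & induces f D.
Proof.
move=> lin_f f0; have fE := cocycle_factor lin_f f0.
have [g gf] := linear_packed lin_f.
have [W WE] := choice defect_bdry.
exists (fun a => g (W a)); last first.
  by move=> a w e; rewrite gf; apply: fE; rewrite e WE.
split=> [a b|c a|a b].
- rewrite -linearD !gf; apply: fE; rewrite linearD !WE.
  by rewrite chiD !scalerDl opprD addrACA.
- rewrite -(linearZZ g) !gf; apply: fE; rewrite (linearZZ d0) !WE.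
  by rewrite chiZ scalerBr algA_act algZ_act.
rewrite -!(linearZZ g) -linearD !gf; apply: fE.
rewrite linearD !(linearZZ d0) !WE.
rewrite chiM !scalerBr scalar_act_comm -(scalerA a b) addrA subrK.
by rewrite algA_act mulrC.
Qed.

Lemma coboundary_inner (f : P 1 -> N) D :
  coboundary1 f -> induces f D -> inner chi D.
Proof.
move=> [g fg] fD; exists (g p) => a; have [w we] := defect_bdry a.
by rewrite -(fD a w we) fg we linearB !(linearZZ g).
Qed.

(** If D is inner, given by n, then sending p to n extends fbar from ker(eps)
    to an A-linear map on P_0 = kp + ker(eps). *)
Lemma inner_coboundary (f : P 1 -> N) D : linear f ->
    (forall x, f (bdry P 1 x) = 0) -> induces f D -> inner chi D ->
  coboundary1 f.
Proof.
move=> lin_f f0 fD [n Dn]; have fE := cocycle_factor lin_f f0.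
have [g gf] := linear_packed lin_f.
have /choice[e eE] : forall q : P 0, exists c : k, eps q = c%:A *: u.
  by move=> q; apply: u_gen.
(* q - e(q)p is the component of q in ker(eps), lifted along d0. *)
have /choice[W WE] : forall q, exists w, d0 w = q - (e q)%:A *: p.
  move=> q; apply/eps_exact.
  by rewrite linearB (linearZZ eps) eps_p eE subrr.
have eD q r : e (q + r) = e q + e r.
  by apply: coord_inj; rewrite -eE linearD !eE !scalerDl.
have eZ a q : e (a *: q) = chi a * e q.
  apply: coord_inj; rewrite -eE (linearZZ eps) eE -scalar_act_comm u_act algA_act.
  by rewrite mulrC.
pose h q : N := (e q)%:A *: n + g (W q).
have lin_h : linear h.
  move=> a q r; have [w we] := defect_bdry a.
  have -> : h (a *: q + r) = ((chi a * e q)%:A *: n + (e r)%:A *: n)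
      + g (a *: W q + W r + (e q)%:A *: w).
    rewrite /h eD eZ !scalerDl !gf; congr (_ + _); apply: fE.
    rewrite !linearD !(linearZZ d0) we !WE eD eZ !scalerBr !scalerDl.
    rewrite scalar_act_comm algA_act [e q * _]mulrC.
    by rewrite [RHS]addrAC [X in _ = X + _]addrA subrK opprD addrACA.
  rewrite /h !linearD !(linearZZ g) [g w]gf (fD _ _ we) Dn !scalerBr scalerDr.
  rewrite scalar_act_comm algA_act [e q * _]mulrC.
  rewrite [LHS]addrC -[LHS]addrA [X in _ + X = _]addrA subrK addrACA.
  by congr (_ + _); rewrite addrC.
have [h' h'E] := linear_packed lin_h; exists h' => x.
rewrite h'E /h; have e0 : e (d0 x) = 0.
  apply: coord_inj; rewrite -eE scale0r scale0r.
  by apply/eps_exact; exists x.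
rewrite e0 scale0r scale0r add0r gf; apply: fE.
by rewrite WE e0 !scale0r subr0.
Qed.

(** Projectivity of P_0 lifts eps to a map h from P_0 to the extension E
    defined by D; on ker(eps) it has values in N.  The inner correction comes
    from the N-component of h(p), which is arbitrary. *)
Lemma derivation_lift D : derivation chi D ->
  exists f : {linear P 1 -> N}, cocycle1 f /\ exists n : N,
    induces f (fun a => D a + (a *: n - (chi a)%:A *: n)).
Proof.
move=> derD; have [DD DZ DM] := derD.
pose E : lmodType A := extension chiD chi1 chiM derD.
have lin_pr : linear (fun v : E => v.2%:A *: u).
  move=> a v w; rewrite /= !scalerDl -scalar_act_comm u_act.
  by rewrite algA_act [v.2 * _]mulrC.
have [pr prE] := linear_packed lin_pr.
have pr_surj : surjective pr.
  move=> m; have [c ->] := u_gen m; exists ((0, c) : E); exact: prE.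
have [h hE] := @res_projective _ _ _ P 0 _ _ pr eps pr_surj.
have h2 q : eps q = 0 -> (h q).2 = 0.
  by move=> q0; apply: coord_inj; rewrite -prE hE q0 !scale0r.
have eps_d x : eps (d0 x) = 0 by apply/eps_exact; exists x.
have lin_f : linear (fun x => (h (d0 x)).1).
  move=> a x y; rewrite /= !linearP /=.
  by rewrite (h2 (d0 x)) ?eps_d // !scale0r addr0.
have [f fE] := linear_packed lin_f; exists f; split.
  move=> x; rewrite fE; have -> : d0 (bdry P 1 x) = 0 by apply/d0_exact; exists x.
  by rewrite linear0.
exists (h p).1 => a w we; rewrite fE we linearB !(linearZZ h) /=.
have hp : (h p).2 = 1.
  by apply: coord_inj; rewrite -prE hE eps_p !scale1r.
rewrite hp !scale1r DZ.
have D1 : D 1 = 0.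
  have := DM 1 1; rewrite mulr1 chi1 !scale1r => e.
  by apply: (addrI (D 1)); rewrite addr0 -e.
by rewrite D1 scaler0 addr0 [LHS]addrAC [LHS]addrC.
Qed.

End Resolution.

(** The correspondence between cocycles and derivations is linear and matches
    coboundaries with inner derivations, so a basis on one side gives a basis
    on the other, whatever the resolution. *)
Theorem ext1_dim_derivation n : derivation_dim chi N n -> ext1_dim M N n.
Proof.
move=> [b bder bP] P; have [p pE] := augm_surj P u.
have /choice[f fP] := fun i => derivation_lift pE (bder i).
have /choice[m mP] := fun i => proj2 (fP i).
have fcoc i := proj1 (fP i).
exists f => // g gcoc.
have [D derD gD] := induced_derivation pE (GRing.linearP g) gcoc.
(* The lifts f_i only induce b_i up to inner derivations, whose combined
   contribution is the inner derivation of s. *)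
have key (c : {ffun 'I_n -> k}) :
    coboundary1 (fun x => g x - \sum_i (c i)%:A *: f i x) <->
    inner chi (fun a => D a - \sum_i (c i)%:A *: b i a).
  have ind : induces p (fun x => g x - \sum_i (c i)%:A *: f i x)
      (fun a => D a - \sum_i (c i)%:A *:
         (b i a + (a *: m i - (chi a)%:A *: m i))).
    move=> a w we; rewrite (gD a w we); congr (_ - _); apply: eq_bigr => i _.
    by rewrite (mP i a w we).
  pose s := \sum_i (c i)%:A *: m i.
  have sE a : \sum_i (c i)%:A *: (b i a + (a *: m i - (chi a)%:A *: m i)) =
      \sum_i (c i)%:A *: b i a + (a *: s - (chi a)%:A *: s).
    rewrite /s !scaler_sumr -sumrB -big_split /=; apply: eq_bigr => i _.
    by rewrite scalerDr scalerBr !(scalar_act_comm (c i)).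
  split=> [cob|[n0 inn]].
    have [n0 n0E] := coboundary_inner pE cob ind; exists (n0 + s) => a.
    have := n0E a; rewrite sE opprD addrA => /(canRL (addrNK _)) ->.
    by rewrite !scalerDr opprD addrACA.
  apply: (inner_coboundary pE _ _ ind).
  - move=> a x y; rewrite linearP scalerBr addrACA; congr (_ + _).
    rewrite scaler_sumr -opprD -big_split /=; congr (- _); apply: eq_bigr => i _.
    by rewrite linearP scalerDr scalar_act_comm.
  - move=> x; rewrite gcoc big1 ?subr0 // => i _.
    by rewrite fcoc scaler0.
  exists (n0 - s) => a; rewrite sE opprD addrA inn !scalerBr.
  by rewrite !opprD !opprK addrACA.
have [c [cP cU]] := bP D derD.
by exists c; split=> [|c' /key]; [apply/key | apply: cU].
Qed.

End Ext1.

(** * Points and faces *)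

Section Geometry.
Variables (R : realType) (d : nat) (A : arrangement R d).
Local Notation V := 'rV[R]_d.
Local Notation form := Defs.form.

Definition sign_of (x : R) : sign :=
  if 0 < x then Pos else if x < 0 then Neg else Zero.

Definition sign_vector (p : V) : {ffun planes A -> sign} :=
  [ffun H => sign_of (form H p)].

Lemma sign_vector_cell p : cell (sign_vector p) p.
Proof.
move=> H _; rewrite /half_space ffunE /sign_of.
by case: ltrgtP => //= h; rewrite formP -h.
Qed.

Lemma face_at_subproof p : `[< classical_sets.nonempty (cell (sign_vector p)) >].
Proof. by apply/asboolP; exists p; exact: sign_vector_cell. Qed.

Definition face_at p : face A := Face (face_at_subproof p).

Lemma face_atE p H : face_at p H = sign_of (form H p).
Proof. by rewrite ffunE. Qed.

Lemma face_at_Zero p H : (face_at p H == Zero) = (p \in val H).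
Proof. by rewrite face_atE formP /sign_of; case: ltrgtP. Qed.

Lemma face_at_cell (x : face A) p : cell x p -> face_at p = x.
Proof.
move=> xp; apply/val_inj/ffunP => H.
exact: half_space_inj (sign_vector_cell p I) (xp H I).
Qed.

Lemma exists_point (x : face A) : exists p, face_at p = x.
Proof. by have [p /face_at_cell] := face_cellP x; exists p. Qed.

Lemma exists_supp (X : lattice A) : exists x : face A, supp x = X.
Proof. by apply/asboolP; case: X. Qed.

Lemma supp_subP (x : face A) (W : {vspace V}) :
  (W <= supp x)%VS = [forall H, (x H == Zero) ==> (W <= val H)%VS].
Proof.
by apply/subv_bigcapP/forall_inP.
Qed.

(** A flat is cut out by hyperplanes of the arrangement, so a point lies in it
    as soon as the point lies on all these hyperplanes. *)
Lemma supp_face_at (X : lattice A) p :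
  (supp (face_at p) <= X)%VS = (p \in (X : {vspace V})).
Proof.
have [z zX] := exists_supp X; rewrite -zX memvE !supp_subP.
by apply: eq_forallb => H; rewrite supp_sub_plane face_at_Zero -memvE.
Qed.

Lemma face_mul_idem (x : face A) : face_mul x x = x.
Proof. by apply/val_inj/ffunP => H; rewrite ffunE; case: (x H). Qed.

Lemma face_mul_lrb (x y : face A) : face_mul (face_mul x y) x = face_mul x y.
Proof. by apply/val_inj/ffunP => H; rewrite !ffunE; case: (x H); case: (y H). Qed.

Lemma face_mul_absorb (x y : face A) :
  (supp y <= supp x)%VS -> face_mul x y = x.
Proof.
move=> yx; apply/val_inj/ffunP => H; rewrite ffunE.
case e: (x H) => //=; apply/eqP; rewrite -supp_sub_plane.
by apply: subv_trans yx _; rewrite supp_sub_plane e.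
Qed.

Lemma supp_flat (x : face A) : exists X : lattice A, flat X = supp x.
Proof.
have W : `[< exists y : face A, supp y = supp x >] by apply/asboolP; exists x.
by exists (Flat W).
Qed.

(** The product of all faces that meet W: a hyperplane contains its support
    iff it contains all these faces, which cover W. *)
Lemma generic_face (W : {vspace V}) :
  exists z : face A, forall H, (z H == Zero) = (W <= val H)%VS.
Proof.
have hprod (s : seq (face A)) : exists z : face A,
    forall H, (z H == Zero) = all (fun x : face A => x H == Zero) s.
  elim: s => [|x s [z zE]]; first by exists (face_one A) => H; rewrite ffunE.
  exists (face_mul x z) => H /=; rewrite -zE ffunE.
  by case: (x H) => //=; case: (z H).
have [z zE] := hprod [seq x <- enum {: face A} |
  `[< exists2 p, p \in W & face_at p = x >]].
exists z => H; rewrite zE; apply/allP/subvP => [h p pW|h x].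
  rewrite -face_at_Zero; apply: h; rewrite mem_filter mem_enum andbT.
  by apply/asboolP; exists p.
by rewrite mem_filter => /andP[/asboolP[p /h pH <-] _]; rewrite face_at_Zero.
Qed.

Lemma flat_capP (X : lattice A) (H : planes A) :
  exists W : lattice A, flat W = (X :&: val H)%VS.
Proof.
have [z zE] := generic_face (X :&: val H).
have zW : supp z = (X :&: val H)%VS.
  apply/eqP; rewrite eqEsubv; apply/andP; split; last first.
    by rewrite supp_subP; apply/forall_inP => K; rewrite zE.
  have [x xX] := exists_supp X; rewrite subv_cap supp_sub_plane zE capvSr andbT.
  rewrite -xX supp_subP; apply/forall_inP => K xK.
  rewrite supp_sub_plane zE; apply: subv_trans (capvSl _ _) _.
  by rewrite -xX supp_sub_plane.
by rewrite -zW; exact: supp_flat.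
Qed.

Lemma exists_plane (X Y : lattice A) : ~~ (X <= Y)%VS ->
  exists2 H : planes A, (Y <= val H)%VS & ~~ (X <= val H)%VS.
Proof.
have [y <-] := exists_supp Y; rewrite supp_subP negb_forall_in.
by move=> /exists_inP[H yH XH]; exists H; rewrite // supp_sub_plane.
Qed.

(** A hyperplane H through Y and not through X gives a flat X :&: H with
    Y <= X :&: H < X, and the covering relation forces equality. *)
Lemma cover_cap (X Y : lattice A) : covers X Y ->
  exists2 H : planes A, ~~ (X <= val H)%VS & flat Y = (X :&: val H)%VS.
Proof.
move=> [YX noZ]; have [YleX XY] : (Y <= X)%VS /\ ~~ (X <= Y)%VS.
  by have := YX; rewrite lt_leAnge => /andP.
have [H YH XH] := exists_plane XY; exists H => //.
have [W WE] := flat_capP X H.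
have WX : (W < X)%O.
  rewrite lt_leAnge; apply/andP; split.
    by rewrite /Order.le /= /flat_le WE capvSl.
  apply: contra XH; rewrite /Order.le /= /flat_le WE => h.
  exact: subv_trans h (capvSr _ _).
have : (Y <= W)%O by rewrite /Order.le /= /flat_le WE subv_cap YleX.
rewrite le_eqVlt => /orP[/eqP -> // |YW]; case: noZ; by exists W.
Qed.

Definition separating p q := [set H : planes A | form H p * form H q < 0 :> R].

(** Where both signs are nonzero they agree, so the order of the factors does
    not matter. *)
Lemma face_at_comm p q : separating p q = set0 ->
  face_mul (face_at p) (face_at q) = face_mul (face_at q) (face_at p).
Proof.
move=> sep; apply/val_inj/ffunP => H; rewrite !ffunE /sign_of.
have : H \notin separating p q by rewrite sep inE.
rewrite inE -leNgt.
case: (ltrgtP 0 (form H p : R)) => hp; case: (ltrgtP 0 (form H q : R)) => hq //=.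
  by rewrite leNgt pmulr_rlt0 // hq.
by rewrite leNgt nmulr_rlt0 // hq.
Qed.

(** What remains of the derivation rule on the faces of X outside Y; it makes f
    constant along inclusions of closures, since y = xy when x is in the closure
    of y. *)
Definition constant_right (T : Type) (X Y : {vspace V}) (f : face A -> T) :=
  forall x y : face A, (supp x <= X)%VS -> ~~ (supp x <= Y)%VS ->
    (supp y <= X)%VS -> f (face_mul x y) = f x.

(** Induction on the number of separating hyperplanes.  If there is none, then
    f(x) = f(xy) = f(yx) = f(y) for the two end faces.  Otherwise cut the
    segment at a point m of a separating hyperplane: m is not separated from
    either end by that hyperplane, and by no hyperplane that does not separate
    the ends. *)
Lemma constant_on_segment (T : Type) (X Y : lattice A) (f : face A -> T) p q :
    constant_right X Y f -> p \in (X : {vspace V}) -> q \in (X : {vspace V}) ->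
    (forall t : R, 0 <= t <= 1 -> (1 - t) *: p + t *: q \notin (Y : {vspace V})) ->
  f (face_at p) = f (face_at q).
Proof.
move=> fX; have [n] := ubnP #|separating p q|.
elim: n p q => // n IH p q; rewrite ltnS => le_n pX qX avoid.
have pY : p \notin (Y : {vspace V}).
  by have := avoid 0; rewrite subr0 scale1r scale0r addr0 lexx ler01; apply.
have qY : q \notin (Y : {vspace V}).
  by have := avoid 1; rewrite subrr scale1r scale0r add0r lexx ler01; apply.
have [sep0|[H]] := set_0Vmem (separating p q).
  rewrite -(fX (face_at p) (face_at q)) ?supp_face_at //.
  by rewrite face_at_comm // fX ?supp_face_at.
rewrite inE => Hpq.
(* The parameter t at which the form of H, which is a at p and b at q,
   vanishes. *)
pose a : R := form H p; pose b : R := form H q; pose t := a / (a - b).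
have ab : a * b < 0 by [].
have ab0 : a - b != 0.
  by rewrite subr_eq0; apply: contraTneq ab => ->; rewrite -leNgt -expr2 sqr_ge0.
have tE : (1 - t) * a + t * b = 0 by rewrite /t; field.
have d2 : 0 < (a - b) ^+ 2 by rewrite exprn_even_gt0.
have t0 : 0 < t.
  rewrite -(pmulr_lgt0 _ d2); have -> : t * (a - b) ^+ 2 = a ^+ 2 - a * b.
    by rewrite /t; field.
  by have := sqr_ge0 a; lra.
have t1 : t < 1.
  rewrite -subr_gt0 -(pmulr_lgt0 _ d2).
  have -> : (1 - t) * (a - b) ^+ 2 = b ^+ 2 - a * b by rewrite /t; field.
  by have := sqr_ge0 b; lra.
pose m := (1 - t) *: p + t *: q.
have formm (K : planes A) : form K m = (1 - t) * form K p + t * form K q :> R.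
  by rewrite /m linearD !linearZ.
have mX : m \in (X : {vspace V}) by rewrite memvD ?memvZ.
have sub1 : separating p m \proper separating p q.
  apply/properP; split.
    apply/subsetP => K; rewrite !inE formm => h.
    set x : R := form K p in h *; set y : R := form K q in h *. nra.
  by exists H; rewrite inE // formm tE mulr0 ltxx.
have sub2 : separating m q \proper separating p q.
  apply/properP; split.
    apply/subsetP => K; rewrite !inE formm => h.
    set x : R := form K p in h *; set y : R := form K q in h *. nra.
  by exists H; rewrite inE // formm tE mul0r ltxx.
transitivity (f (face_at m)); apply: IH => //.
- exact: leq_trans (proper_card sub1) le_n.
- move=> s /andP[s0 s1]; rewrite /m.
  have -> : (1 - s) *: p + s *: ((1 - t) *: p + t *: q) =
      (1 - s * t) *: p + (s * t) *: q.
    rewrite scalerDr !scalerA addrA -scalerDl; congr (_ *: _ + _); ring.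
  by apply: avoid; nra.
- exact: leq_trans (proper_card sub2) le_n.
- move=> s /andP[s0 s1]; rewrite /m.
  have -> : (1 - s) *: ((1 - t) *: p + t *: q) + s *: q =
      (1 - (t + s * (1 - t))) *: p + (t + s * (1 - t)) *: q.
    rewrite scalerDr !scalerA -addrA -scalerDl; congr (_ *: _ + _ *: _); ring.
  by apply: avoid; nra.
Qed.

(** Y + <[p]> is properly contained in X for dimension reasons; a segment from
    one of its points outside Y to a point of X outside Y + <[p]> avoids Y. *)
Lemma constant_of_gap (T : Type) (X Y Z : lattice A) (f : face A -> T) p q :
    (Y < Z)%O -> (Z < X)%O -> constant_right X Y f ->
    p \in (X : {vspace V}) -> q \in (X : {vspace V}) ->
    p \notin (Y : {vspace V}) -> q \notin (Y : {vspace V}) ->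
  f (face_at p) = f (face_at q).
Proof.
move=> YZ ZX fX pX qX pY qY.
have dim_lt (S T' : lattice A) : (S < T')%O -> (\dim S < \dim T')%N.
  rewrite lt_leAnge /Order.le /= /flat_le => /andP[ST TS].
  by rewrite (ltn_leqif (dimv_leqif_sup ST)).
have [r rX rYp] : exists2 r, r \in (X : {vspace V}) & r \notin (Y + <[p]>)%VS.
  apply/subvPn; apply/negP => /dimvS; apply/negP; rewrite -ltnNge.
  apply: leq_ltn_trans (leq_of_leqif (dimv_add_leqif _ _)) _; rewrite dim_vline.
  apply: leq_ltn_trans (leq_add (leqnn _) (leq_b1 _)) _.
  by rewrite addn1; apply: leq_ltn_trans (dim_lt _ _ YZ) (dim_lt _ _ ZX).
have far v w : v \in (X : {vspace V}) -> v \notin (Y : {vspace V}) ->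
    v \in (Y + <[p]>)%VS -> w \in (X : {vspace V}) -> w \notin (Y + <[p]>)%VS ->
    f (face_at v) = f (face_at w).
  move=> vX vY vYp wX wYp; apply: (constant_on_segment fX) => // t _.
  have [->|t0] := eqVneq t 0; first by rewrite subr0 scale1r scale0r addr0.
  apply: contra wYp => vwY.
  have -> : w = t^-1 *: ((1 - t) *: v + t *: w - (1 - t) *: v).
    by rewrite addrC addKr scalerA mulVf // scale1r.
  by rewrite memvZ // memvB ?memvZ //; apply: (subvP (addvSl _ _)).
have pYp : p \in (Y + <[p]>)%VS by apply: (subvP (addvSr _ _)); exact: memv_line.
have [qYp|qYp] := boolP (q \in (Y + <[p]>)%VS); last exact: far.
by rewrite (far p r) // (far q r).
Qed.

End Geometry.

Arguments face_at {R d A} p.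

(** * Derivations of the face semigroup *)

Section FaceDerivations.
Variables (k : fieldType) (R : realType) (d : nat) (A : arrangement R d).
Local Notation V := 'rV[R]_d.
Local Notation form := Defs.form.
Local Notation chi X := (supp_le k X).

Definition face_derivation (X Y : lattice A) (delta : face A -> k) : Prop :=
  forall x y, delta (face_mul x y) = chi Y x * delta y + chi X y * delta x.

Definition face_inner (X Y : lattice A) (delta : face A -> k) : Prop :=
  exists c, forall x, delta x = (chi Y x - chi X x) * c.

(** By xx = x, the value of delta at x is 2 delta(x) or 0. *)
Lemma face_derivation_eq0 X Y delta x : face_derivation X Y delta ->
  (supp x <= X)%VS = (supp x <= Y)%VS -> delta x = 0.
Proof.
move=> der e; have := der x x; rewrite face_mul_idem /supp_le e.
case: (_ <= _)%VS; rewrite ?mul0r ?addr0 // mul1r => dd.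
by apply: (addrI (delta x)); rewrite addr0 -dd.
Qed.

(** For a face y of support Y, compare delta(yxy) with delta(yx). *)
Lemma face_derivation_inner X Y delta :
  face_derivation X Y delta -> ~~ (Y <= X)%VS -> face_inner X Y delta.
Proof.
move=> der YX; have [y yY] := exists_supp Y; exists (delta y) => x.
have := der y x; have := der (face_mul y x) y.
have chiM Z u v : chi Z (face_mul u v) = chi Z u * chi Z v.
  exact: (supp_le_mmorphism k Z).1.
rewrite face_mul_lrb !chiM => -> /eqP.
rewrite /supp_le yY subvv (negPf YX) mulr0n mul0r addr0 !mul1r.
by rewrite mulrBl => /eqP ->; rewrite addrK.
Qed.

Lemma face_derivation_constant_right X Y delta : face_derivation X Y delta ->
  constant_right X Y delta.
Proof.
move=> der x y xX xY yX.
by rewrite der /supp_le (negPf xY) yX mul0r add0r mul1r.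
Qed.

Lemma face_derivation_noncover X Y delta :
  face_derivation X Y delta -> ~ covers X Y -> face_inner X Y delta.
Proof.
move=> der ncov; have [YX|] := boolP (Y <= X)%VS; last first.
  exact: face_derivation_inner der.
have [XY|XY] := boolP (X <= Y)%VS.
  have e : X = Y by apply: val_inj; apply/eqP; rewrite eqEsubv XY.
  by exists 0 => x; rewrite mulr0; apply: (face_derivation_eq0 der); rewrite e.
have ltYX : (Y < X)%O by rewrite lt_leAnge; apply/andP.
have [Z [YZ ZX]] : exists Z : lattice A, (Y < Z)%O /\ (Z < X)%O.
  by apply/not_existsP => h; apply: ncov; split=> // -[Z hZ]; apply: (h Z).
have [p pX pY] : exists2 p, p \in (X : {vspace V}) & p \notin (Y : {vspace V}).
  exact/subvPn.
exists (- delta (face_at p)) => x; rewrite /supp_le.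
have [xY|xY] := boolP (supp x <= Y)%VS.
  have xX := subv_trans xY YX.
  by rewrite xX subrr mul0r; apply: (face_derivation_eq0 der); rewrite xX xY.
have [xX|xX] := boolP (supp x <= X)%VS; last first.
  rewrite subrr mul0r; apply: (face_derivation_eq0 der).
  by rewrite (negPf xX) (negPf xY).
rewrite sub0r mulN1r opprK; have [q qx] := exists_point x.
move: xX xY; rewrite -qx !supp_face_at => qX qY.
exact: (constant_of_gap YZ ZX (face_derivation_constant_right der)).
Qed.

Section Cover.
Variables (X Y : lattice A) (H : planes A).
Hypotheses (XH : ~~ (X <= val H)%VS) (YE : flat Y = (X :&: val H)%VS).

(** A derivation that is not inner: it tells the two sides of H in X apart. *)
Definition positive_side (x : face A) : k :=
  ((supp x <= X)%VS && (x H == Pos))%:R.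

Lemma supp_le_cap x : (supp x <= Y)%VS = (supp x <= X)%VS && (x H == Zero).
Proof. by rewrite YE subv_cap supp_sub_plane. Qed.

Lemma positive_side_derivation : face_derivation X Y positive_side.
Proof.
move=> x y; rewrite /positive_side /supp_le !supp_le_cap supp_mul ffunE.
case: (supp x <= X)%VS; case: (supp y <= X)%VS => /=;
  rewrite ?mul0r ?mulr0 ?add0r ?mul1r ?addr0 //=;
  by case: (x H) => /=; rewrite ?mul1r ?mul0r ?add0r ?addr0.
Qed.

Lemma exists_positive_point : exists2 p, p \in (X : {vspace V}) & 0 < form H p :> R.
Proof.
have [p pX] := subvPn XH; rewrite formP => fp.
have [h|h|h] := ltrgtP 0 (form H p : R); first by exists p.
  by exists (- p); rewrite ?memvN // linearN oppr_gt0.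
by rewrite -h eqxx in fp.
Qed.

(** On each side of H in X, delta is constant by convexity.  The coefficient c
    is the difference of the two values, because inner derivations take the
    same value on both sides. *)
Lemma face_derivation_cover delta : face_derivation X Y delta ->
  exists! c : k, face_inner X Y (fun x => delta x - c * positive_side x).
Proof.
move=> der; have [p pX pH] := exists_positive_point.
have nX : - p \in (X : {vspace V}) by rewrite memvN.
have nH : form H (- p) < 0 :> R by rewrite linearN oppr_lt0.
have avoid v : form H v != 0 -> v \notin (Y : {vspace V}).
  by apply: contra; rewrite YE memv_cap formP => /andP[].
have formS (t : R) u v :
    form H ((1 - t) *: u + t *: v) = (1 - t) * form H u + t * form H v :> R.
  by rewrite linearD !linearZ.
have pos q : q \in (X : {vspace V}) -> 0 < form H q :> R ->
    delta (face_at q) = delta (face_at p).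
  move=> qX qH.
  apply: (constant_on_segment (face_derivation_constant_right der)) => //.
  by move=> t /andP[t0 t1]; apply/avoid/lt0r_neq0; rewrite formS; nra.
have neg q : q \in (X : {vspace V}) -> form H q < 0 :> R ->
    delta (face_at q) = delta (face_at (- p)).
  move=> qX qH.
  apply: (constant_on_segment (face_derivation_constant_right der)) => //.
  by move=> t /andP[t0 t1]; apply/avoid/ltr0_neq0; rewrite formS; nra.
exists (delta (face_at p) - delta (face_at (- p))); split.
  exists (- delta (face_at (- p))) => x; rewrite /positive_side /supp_le.
  rewrite supp_le_cap; have [xX|xX] := boolP (supp x <= X)%VS; last first.
    rewrite mulr0 !subr0 mul0r; apply: (face_derivation_eq0 der).
    by rewrite supp_le_cap (negPf xX).
  have [q qx] := exists_point x; move: xX; rewrite -qx supp_face_at /= => qX.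
  rewrite face_atE /sign_of; case: ltrgtP => /= qH.
  - by rewrite pos //; ring.
  - by rewrite neg //; ring.
  rewrite mulr0 subrr mul0r subr0; apply: (face_derivation_eq0 der).
  by rewrite supp_le_cap supp_face_at qX face_at_Zero formP -qH eqxx.
move=> c [n nE]; have := nE (face_at p); have := nE (face_at (- p)).
rewrite /positive_side /supp_le !supp_le_cap !supp_face_at pX nX /= !face_atE.
rewrite /sign_of pH nH (lt_gtF nH) /= => en ep.
rewrite [LHS](_ : _ = (delta (face_at p) - c * true%:R)
  - (delta (face_at (- p)) - c * false%:R) + c); last by rewrite /=; ring.
by rewrite en ep subrr add0r.
Qed.

End Cover.
End FaceDerivations.

(** * From the face semigroup to its algebra *)

Lemma malgU_scale (K : choiceType) (k : nzRingType) (c : k) (x : K) :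
  << c *g x >> = c *: (<< x >> : {malg k[K]}).
Proof. by apply/malgP => y; rewrite mcoeffZ !mcoeffU mulrnAr mulr1. Qed.

(** When A acts by scalars, every line is a submodule. *)
Lemma simple_module_line (k : fieldType) (A : algType k) (M : lmodType A)
    (chi : A -> k) : simple_module M ->
    (forall (a : A) (v : M), a *: v = (chi a)%:A *: v) ->
  exists (m : M) (co : M -> k), [/\ forall v, v = (co v)%:A *: m,
    forall c, co (c%:A *: m) = c
    & forall a u v, co (a *: u + v) = chi a * co u + co v].
Proof.
move=> [[m m0] Mmin] aE.
have /choice[co coE] : forall v, exists c : k, v = c%:A *: m.
  move=> v; pose S : {pred M} := fun v => `[< exists c : k, v = c%:A *: m >].
  have clS : submod_closed S.
    split; first by apply/asboolP; exists 0; rewrite scale0r scale0r.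
    move=> a u w /asboolP[c ->] /asboolP[e ->]; apply/asboolP.
    by exists (chi a * c + e); rewrite aE algA_act !scalerDl.
  case: (Mmin S clS) => [S0|/(_ v)]; last by rewrite inE => /asboolP.
  have := S0 m; rewrite !inE (negPf m0) => /negP[]; apply/asboolP; exists 1.
  by rewrite !scale1r.
exists m, co; split=> // [c|a u v]; apply: (algA_act_inj m0); rewrite -coE //.
by rewrite {1}(coE u) {1}(coE v) aE algA_act !scalerDl.
Qed.

Section Spanning.
Variables (k : fieldType) (A : algType k).

Definition klinear (f : A -> k) : Prop :=
  (forall a b, f (a + b) = f a + f b) /\ (forall (c : k) a, f (c *: a) = c * f a).

Lemma klinear0 f : klinear f -> f 0 = 0.
Proof. by case=> _ fZ; rewrite -(scale0r (1 : A)) fZ mul0r. Qed.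

(** An induction principle instead of a formula for the elements, because that
    is how spanning is used. *)
Definition spanned_by (T : Type) (e : T -> A) : Prop :=
  forall Q : A -> Prop, Q 0 -> (forall a b, Q a -> Q b -> Q (a + b)) ->
    (forall (c : k) x, Q (c *: e x)) -> forall a, Q a.

Variables (T : Type) (e : T -> A).
Hypothesis span : spanned_by e.

Lemma klinear_ext (f g : A -> k) : klinear f -> klinear g ->
  (forall x, f (e x) = g (e x)) -> forall a, f a = g a.
Proof.
move=> flin glin fg; have [[fD fZ] [gD gZ]] := (flin, glin).
apply: span => [|a b Ha Hb|c x]; first by rewrite !klinear0.
  by rewrite fD gD Ha Hb.
by rewrite fZ gZ fg.
Qed.

(** Both sides are bilinear in a and b, so it suffices to compare them on the
    spanning elements. *)
Lemma klinear_leibniz (f g h : A -> k) : klinear f -> klinear g -> klinear h ->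
    (forall x y, f (e x * e y) = g (e x) * f (e y) + h (e y) * f (e x)) ->
  forall a b, f (a * b) = g a * f b + h b * f a.
Proof.
move=> flin glin hlin fgh a b.
have [[fD fZ] [gD gZ] [hD hZ]] := And3 flin glin hlin.
elim/span: a => [|a a' Ha Ha'|c x].
- by rewrite mul0r !klinear0 // mul0r mulr0 addr0.
- by rewrite mulrDl !fD gD Ha Ha' mulrDl mulrDr addrACA.
rewrite -scalerAl !fZ gZ -mulrA [h b * _]mulrCA -mulrDr; congr (_ * _).
elim/span: b => [|b b' Hb Hb'|c' y].
- by rewrite mulr0 !klinear0 // mulr0 mul0r addr0.
- by rewrite mulrDr !fD hD Hb Hb' mulrDl mulrDr addrACA.
by rewrite -scalerAr !fZ hZ fgh mulrDr mulrCA -mulrA.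
Qed.

Lemma act_by_character (M : lmodType A) (m : M) (chi : A -> k) : klinear chi ->
  (forall x, e x *: m = (chi (e x))%:A *: m) ->
  forall a, a *: m = (chi a)%:A *: m.
Proof.
move=> chilin em; have [chiD chiZ] := chilin.
apply: span => [|a b Ha Hb|c x]; first by rewrite klinear0 // !scale0r.
  by rewrite chiD !scalerDl Ha Hb.
by rewrite chiZ algZ_act em algA_act.
Qed.

Lemma act_stable (M : lmodType A) (S : {pred M}) (m : M) :
    0 \in S -> {in S &, forall u v, u + v \in S} ->
    (forall (c : k) u, u \in S -> c%:A *: u \in S) ->
    (forall x, e x *: m \in S) ->
  forall a, a *: m \in S.
Proof.
move=> S0 SD SZ Se; apply: span => [|a b Ha Hb|c x]; first by rewrite scale0r.
  by rewrite scalerDl SD.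
by rewrite algZ_act SZ.
Qed.
End Spanning.

Section FaceAlgebra.
Variables (k : fieldType) (R : realType) (d : nat) (A : arrangement R d).
Local Notation B := (face_algebra k A).

Definition face_elt (x : face A) : B := << x >>.

Lemma face_algebra_spanned : spanned_by face_elt.
Proof.
move=> Q Q0 QD QU a; rewrite [a](@monalgE (face A) k).
apply: (big_ind Q) => // x _.
rewrite malgU_scale; exact: QU.
Qed.

Lemma faceM (x y : face A) : (<< x >> : B) * (<< y >> : B) = << face_mul x y >>.
Proof. by rewrite [LHS](@malgM_def (face A) k) fgmulUU mulr1. Qed.

Lemma act_face (X : lattice A) (x : face A) : act X (<< x >> : B) = supp_le k X x.
Proof. by rewrite /act mmapU mul1r. Qed.

Lemma act_linear (X : lattice A) : klinear (act X : B -> k).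
Proof.
split; first exact: (@mmapD (face A) k k idfun (supp_le k X)).
by move=> c a; rewrite /act linearZ.
Qed.

Lemma act_alg (X : lattice A) (c : k) : act X (c%:A : B) = c.
Proof. by rewrite (act_linear X).2 /act rmorph1 mulr1. Qed.

Lemma simple_at_scale (X : lattice A) (a : B) (v : simple_at k X) :
  a *: v = act X a * v :> k.
Proof. by []. Qed.

Lemma simple_at_alg (X : lattice A) (c : k) (v : simple_at k X) :
  (c%:A : B) *: v = c * v :> k.
Proof. by rewrite simple_at_scale act_alg. Qed.

Section Derivations.
Variables (X Y : lattice A).

Definition on_faces (D : B -> simple_at k Y) : face A -> k := fun x => D << x >>.

Definition extend_faces (delta : face A -> k) (a : B) : simple_at k Y :=
  mmap idfun delta a.

Lemma extend_faces_face delta x : extend_faces delta << x >> = delta x.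
Proof. by rewrite /extend_faces mmapU mul1r. Qed.

Lemma extend_faces_linear delta : klinear (extend_faces delta).
Proof.
split=> [a b|c a]; first exact: (@mmapD (face A) k k idfun delta).
rewrite /extend_faces (mmapEw (msuppZ_le c a)) mmapE big_distrr /=.
by apply: eq_bigr => x _; rewrite mcoeffZ mulrA.
Qed.

Lemma on_faces_derivation D :
  derivation (act X) D -> face_derivation X Y (on_faces D).
Proof.
move=> [_ _ DM] x y; rewrite /on_faces -faceM DM simple_at_scale simple_at_alg.
by rewrite !act_face.
Qed.

Lemma extend_faces_derivation delta :
  face_derivation X Y delta -> derivation (act X) (extend_faces delta).
Proof.
move=> der; have elin := extend_faces_linear delta; split; first exact: elin.1.
  by move=> c a; rewrite simple_at_alg; exact: elin.2.
move=> a b; rewrite simple_at_scale simple_at_alg.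
apply: (klinear_leibniz face_algebra_spanned elin
  (act_linear Y) (act_linear X)) => x y.
have e z : extend_faces delta (face_elt z) = delta z by exact: extend_faces_face.
have c Z z : act Z (face_elt z) = supp_le k Z z by exact: act_face.
transitivity (supp_le k Y x * delta y + supp_le k X y * delta x).
  rewrite -der -e; congr (extend_faces _ _); exact: faceM.
by congr (_ * _ + _ * _).
Qed.

Lemma inner_on_faces (D : B -> simple_at k Y) : derivation (act X) D ->
  inner (act X) D <-> face_inner X Y (on_faces D).
Proof.
move=> [DD DZ _]; split=> -[n nE]; exists n.
  move=> x; rewrite /on_faces nE simple_at_scale simple_at_alg !act_face.
  by rewrite mulrBl.
move=> a; rewrite simple_at_scale simple_at_alg -mulrBl.
have Dlin : klinear D by split=> // c b; rewrite DZ simple_at_alg.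
have innlin : klinear (fun b => (act Y b - act X b) * n).
  have [[YD YZ] [XD XZ]] := (act_linear Y, act_linear X).
  split=> [b b'|c b]; first by rewrite YD XD opprD addrACA mulrDl.
  by rewrite YZ XZ -mulrBr mulrA.
move: a; apply: (klinear_ext face_algebra_spanned Dlin innlin) => x.
by rewrite !act_face -nE.
Qed.

Lemma derivation_dim_noncover :
  ~ covers X Y -> derivation_dim (act X) (simple_at k Y : lmodType B) 0.
Proof.
move=> ncov; exists (fun i _ => 0); first by case.
move=> D derD; exists [ffun=> 0]; split; last by move=> c _; apply/ffunP; case.
have [n nE] : inner (act X) D.
  apply/(inner_on_faces derD); apply: face_derivation_noncover ncov.
  exact: on_faces_derivation.
by exists n => a; rewrite big_ord0 subr0.
Qed.

Lemma derivation_dim_cover :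
  covers X Y -> derivation_dim (act X) (simple_at k Y : lmodType B) 1.
Proof.
move=> /cover_cap [H XH YE]; pose D0 := extend_faces (positive_side k X H).
have der0 : derivation (act X) D0.
  exact/extend_faces_derivation/positive_side_derivation.
exists (fun=> D0) => // D derD.
have [c [cP cU]] := face_derivation_cover XH YE (on_faces_derivation derD).
have key (e : {ffun 'I_1 -> k}) :
    inner (act X) (fun a => D a - \sum_i (e i)%:A *: D0 a) <->
    face_inner X Y (fun x => on_faces D x - e ord0 * positive_side k X H x).
  have -> : (fun a => D a - \sum_i (e i)%:A *: D0 a) =
      fun a => D a - (e ord0)%:A *: D0 a.
    by apply/funext => a; rewrite big_ord1.
  have <- : on_faces (fun a => D a - (e ord0)%:A *: D0 a) =
      fun x => on_faces D x - e ord0 * positive_side k X H x.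
    apply/funext => x; rewrite /on_faces simple_at_alg.
    by rewrite /D0 extend_faces_face.
  exact: inner_on_faces (derivation_sub_scale _ derD der0).
exists [ffun=> c]; split; first by apply/key; rewrite ffunE.
by move=> e /key /cU ce; apply/ffunP => i; rewrite ffunE ord1.
Qed.

Lemma ext1_simple_at :
  ext1_dim (simple_at k X : lmodType B) (simple_at k Y : lmodType B)
    (if `[< covers X Y >] then 1%N else 0%N).
Proof.
pose u : simple_at k X := (1 : k).
have gen (m : simple_at k X) : exists c : k, m = (c%:A : B) *: u.
  by exists m; rewrite simple_at_alg mulr1.
have act1 (a : B) :
    a *: u = ((act X a)%:A : B) *: u.
  by rewrite simple_at_alg.
apply: (ext1_dim_derivation (oner_neq0 k : u != 0) gen act1).
case: ifPn => /asboolP; first exact: derivation_dim_cover.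
exact: derivation_dim_noncover.
Qed.
End Derivations.

(** * Simple modules *)

Lemma face_algebra_dim : exists n, kdim (B^o : lmodType B) n.
Proof.
exists #|{: face A}|; exists (fun i => << enum_val i >> : B) => a.
have coefE (e : k) (x y : face A) :
    ((e%:A : B) *: (<< x >> : B^o) : {malg k[face A]})@_y = e *+ (x == y).
  have -> : (e%:A : B) *: (<< x >> : B^o) = e *: (<< x >> : B).
    by exact: (@mulr_algl k B e (face_elt x)).
  by rewrite mcoeffZ mcoeffU mulrnAr mulr1.
have sumE (c : {ffun 'I_#|{: face A}| -> k}) (x : face A) :
    (\sum_i (c i)%:A *: (<< enum_val i >> : B^o) : {malg k[face A]})@_x =
    c (enum_rank x).
  rewrite raddf_sum (bigD1 (enum_rank x)) //= big1 ?addr0 => [|i ix].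
    by rewrite coefE enum_rankK eqxx.
  by rewrite coefE -(can_eq (@enum_rankK _)) enum_valK (negPf ix).
exists [ffun i => (a : {malg k[face A]})@_(enum_val i)]; split => [|c ->].
  by apply/malgP => x; rewrite sumE ffunE enum_rankK.
by apply/ffunP => i; rewrite ffunE sumE enum_valK.
Qed.

Lemma simple_at_simple (X : lattice A) : simple_module (simple_at k X : lmodType B).
Proof.
split; first by exists (1 : k); exact: oner_neq0.
move=> S [S0 SD]; have [[v [Sv v0]]|no] := pselect (exists v, v \in S /\ v != 0).
  right=> w; rewrite !inE; have -> : w = (w / v : k)%:A *: v + 0.
    by rewrite addr0 [RHS]simple_at_alg divfK.
  exact: SD.
left=> w; rewrite inE; apply/idP/eqP => [Sw|-> //].
by apply/eqP; apply: contra_notT no => w0; exists w.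
Qed.

(** An isomorphism preserves the character by which B acts, and X is the
    largest flat Z such that chi_X is 1 on the faces of support Z. *)
Lemma simple_at_iso_eq (X Y : lattice A) :
  isomorphic (simple_at k X : lmodType B) (simple_at k Y : lmodType B) -> X = Y.
Proof.
move=> [f fbij]; pose u : simple_at k X := (1 : k).
have fu : f u != 0.
  by rewrite -(linear0 f) (inj_eq (bij_inj fbij)); exact: oner_neq0.
have act_eq (a : B) : act X a = act Y a.
  have au : a *: u = ((act X a)%:A : B) *: u by rewrite simple_at_alg.
  apply: (mulIf (fu : f u != 0 :> k)).
  have := congr1 f au; rewrite !(linearZZ f) simple_at_scale simple_at_alg.
  exact: esym.
have le (Z : lattice A) : (Z <= X)%VS = (Z <= Y)%VS.
  have [z <-] := exists_supp Z; have := act_eq (face_elt z); rewrite !act_face.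
  rewrite /supp_le; case: (_ <= X)%VS; case: (_ <= Y)%VS => // /eqP;
    by rewrite ?oner_eq0 // eq_sym oner_eq0.
by apply/val_inj/eqP; rewrite eqEsubv -le subvv le subvv.
Qed.

(** The face x of largest support among those that do not kill M acts
    injectively, and X is its support. *)
Lemma simple_module_act (M : lmodType B) : simple_module M ->
  exists X : lattice A, forall (a : B) (m : M), a *: m = (act X a)%:A *: m.
Proof.
move=> [[m0 m00] Mmin].
pose acts x := `[< exists m : M, (<< x >> : B) *: m != 0 >].
have acts1 : acts (face_one A).
  by apply/asboolP; exists m0; rewrite (scale1r m0).
case: (arg_maxnP (fun x => \dim (supp x)) acts1) => x /asboolP [m1 xm1] xmax.
have [X XE] := supp_flat x; exists X.
have x_eq0 (y : face A) (m : M) : ~~ (supp y <= supp x)%VS ->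
    (<< x >> : B) *: ((<< y >> : B) *: m) = 0.
  move=> yx; rewrite scalerA faceM; apply/eqP; apply: contraNT yx => xym.
  have [W WE] := supp_flat (face_mul x y).
  have : (supp (face_mul x y) <= W)%VS by rewrite WE.
  rewrite supp_mul WE => /andP[xxy yxy].
  have /xmax : acts (face_mul x y) by apply/asboolP; exists m.
  by rewrite /= (geq_leqif (dimv_leqif_sup xxy)); exact: subv_trans.
pose S : {pred M} := [pred m | (<< x >> : B) *: m == 0].
have S0 : S =i pred1 0.
  have clS : submod_closed S.
    split; first by rewrite inE scaler0.
    move=> a u v uS vS; suff : a *: u \in S.
      by move: vS; rewrite !inE scalerDr => /eqP -> /eqP ->; rewrite addr0.
    have xu : (<< x >> : B) *: u = 0 by apply/eqP.
    move: a; apply: (act_stable face_algebra_spanned) => [|w t|c w|y].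
    - by rewrite inE scaler0.
    - by rewrite !inE scalerDr => /eqP -> /eqP ->; rewrite addr0.
    - by rewrite !inE -scalar_act_comm => /eqP ->; rewrite scaler0.
    rewrite inE /face_elt.
    have [yx|yx] := boolP (supp y <= supp x)%VS; last by rewrite x_eq0.
    by rewrite scalerA faceM face_mul_absorb // xu.
  case: (Mmin S clS) => // /(_ m1); rewrite !inE => /eqP xm10.
  by rewrite xm10 eqxx in xm1.
have xinj (m : M) : (<< x >> : B) *: m = 0 -> m = 0.
  by move=> xm; apply/eqP; have := S0 m; rewrite !inE xm eqxx => <-.
move=> a m; move: a.
apply: (act_by_character face_algebra_spanned (act_linear X)) => y.
rewrite /face_elt act_face /supp_le XE.
have [yx|yx] := boolP (supp y <= supp x)%VS; last first.
  by rewrite mulr0n !scale0r; apply: xinj; rewrite x_eq0.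
rewrite mulr1n (scale1r 1) [RHS]scale1r.
apply/eqP; rewrite -subr_eq0; apply/eqP/xinj.
by rewrite scalerBr scalerA faceM face_mul_absorb // subrr.
Qed.

Lemma simple_module_iso (M : lmodType B) : simple_module M ->
  kdim M 1 /\ exists X : lattice A, isomorphic M (simple_at k X : lmodType B).
Proof.
move=> Msimple; have [X aE] := simple_module_act Msimple.
have [m [co [coE coK colin]]] := simple_module_line Msimple aE; split.
  exists (fun=> m) => v; exists [ffun=> co v]; split => [|c ->].
    by rewrite big_ord1 ffunE.
  by apply/ffunP => i; rewrite ffunE big_ord1 coK (ord1 i).
have [f fE] := linear_packed (colin : linear (co : M -> simple_at k X)).
by exists X, f; exists (fun c : k => c%:A *: m) => [v|c]; rewrite fE ?coK //.
Qed.

End FaceAlgebra.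

Theorem corollary8p4 (k : fieldType) (R : realType) (d : nat)
    (A : arrangement R d) :
  @is_ext_quiver k (face_algebra k A) (hasse_quiver (lattice A))
    (fun X : lattice A => simple_at k X).
Proof.
split.
- exact: face_algebra_dim.
- by move=> M /simple_module_iso[].
- split.
  + exact: simple_at_simple.
  + exact: simple_at_iso_eq.
  + by move=> M /simple_module_iso[].
by move=> X Y; exact: ext1_simple_at.
Qed.
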